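(* Let $n\ge5$ and $K>0$. Up to global phase shifts and integer translations, the equilibria of the nearest-neighbor Kuramoto model with $\sigma=(\sigma_0,\dots,\sigma_{n-1})=(1,\dots,1,-1)$ are of the form $$u^{(r)}_i=\frac{\hat q\,i}{n},\quad i=0,\dots,n-1,\qquad \hat q=\frac{rn}{n-2},$$ where $r\in\mathbb{Z}+\frac12$ is any half-integer satisfying $$-\frac n4+\frac12<r<\frac n4-\frac12 .$$
   Context: Indices are in $\Lambda=\mathbb{Z}/n\mathbb{Z}$ with representatives $0,\dots,n-1$. The potential is $U(u)=-\frac{K}{2\pi}\sum_{i\in\Lambda}\cos(2\pi(u_{i+1}-u_i))$, and equilibria are the points $u\in\mathbb{R}^{\Lambda}$ with $\nabla U(u)=0$, i.e. $\sin(2\pi(u_{i+1}-u_i))=\sin(2\pi(u_i-u_{i-1}))$ for all $i\in\Lambda$. Global phase shifts are $u\mapsto u+\varphi(1,\dots,1)$, $\varphi\in\mathbb{R}$; integer translations are $u\mapsto u+k$, $k\in\mathbb{Z}^{\Lambda}$. For an equilibrium put $a_i=(u_{i+1}-u_i)\bmod 1$. Either all $a_i$ are equal, or they take exactly two different values $a$ and $\hat a=\frac12-a\pmod 1$, named so that $\cos(2\pi a)>0>\cos(2\pi\hat a)$. In the latter case, $\sigma_i=1$ if $a_i=a$ and $\sigma_i=-1$ if $a_i=\hat a$. *)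

(* Defs.v *)
From mathcomp Require Import all_boot all_order all_algebra.
From mathcomp Require Import all_classical all_reals all_analysis.

Set Implicit Arguments.
Unset Strict Implicit.
Unset Printing Implicit Defensive.

Import Order.TTheory GRing.Theory Num.Theory.
Import numFieldNormedType.Exports.

Local Open Scope classical_set_scope.
Local Open Scope ring_scope.

(* Z/nZ is represented by 'I_n; [ordS] is the cyclic successor i |-> i + 1.
   A phase configuration u in R^(Z/nZ) is a row vector. *)

Definition kuramoto_potential (R : realType) (n : nat) (K : R)
    (u : 'rV[R]_n) : R :=
  - (K / (2 * pi)) * \sum_(i < n) cos (2 * pi * (u 0 (ordS i) - u 0 i)).

Definition gradient (R : realType) (n : nat) (f : 'rV[R]_n -> R)
    (u : 'rV[R]_n) : 'rV[R]_n :=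
  \row_(i < n) 'D_(delta_mx 0 i) f u.

Definition equilibrium (R : realType) (n : nat) (K : R) (u : 'rV[R]_n) : Prop :=
  gradient (kuramoto_potential K) u = 0.

Definition mod1 (R : realType) (x : R) : R := x - (Num.floor x)%:~R.

Definition phase_diff (R : realType) (n : nat) (u : 'rV[R]_n) (i : 'I_n) : R :=
  mod1 (u 0 (ordS i) - u 0 i).

(* The condition on the cosines forces a <> ahat and determines which of the
   two values is called a; hence s is uniquely determined by u.  When all phase
   differences are equal, u has no sign vector. *)
Definition has_sigma (R : realType) (n : nat) (u : 'rV[R]_n)
    (s : 'rV[int]_n) : Prop :=
  exists a ahat : R,
    [/\ range (phase_diff u) = [set a; ahat],
        ahat = mod1 (1 / 2 - a),
        cos (2 * pi * ahat) < 0 < cos (2 * pi * a) &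
        forall i, s 0 i = if phase_diff u i == a then 1 else -1].

Definition last_minus (n : nat) : 'rV[int]_n :=
  \row_(i < n) (if i == n.-1 :> nat then -1 else 1).

(* equality up to global phase shifts and integer translations *)
Definition shift_equiv (R : realType) (n : nat) (u v : 'rV[R]_n) : Prop :=
  exists (phi : R) (k : 'rV[int]_n),
    u = v + const_mx phi + map_mx intr k.

Definition half_integer (R : realType) (r : R) : Prop :=
  exists m : int, r = m%:~R + 1 / 2.

Definition qhat (R : realType) (n : nat) (r : R) : R :=
  r * n%:R / (n%:R - 2).

Definition u_r (R : realType) (n : nat) (r : R) : 'rV[R]_n :=
  \row_(i < n) (qhat n r * i%:R / n%:R).

(* Main.v *)
Require Import Defs.
From mathcomp Require Import all_boot all_order all_algebra.
From mathcomp Require Import all_classical all_reals all_analysis.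
From mathcomp Require Import ring lra.

Import Order.TTheory GRing.Theory Num.Theory.
Import numFieldNormedType.Exports.

Local Open Scope ring_scope.

(* Modulo 1 the differences of u sum to 0; they are t (n - 1 times) and 1/2 - t
   (once), so (n - 2) t is congruent to 1/2 modulo 1, and cos(2 pi t) > 0 allows
   to choose |t| < 1/4. This gives r = (n - 2) t. Conversely
   sin(2 pi t) = sin(2 pi (1/2 - t)) makes the gradient vanish. *)

Section Turns.
Variable R : realType.
Implicit Types x y : R.

Lemma periodic_intr (f : R -> R) (T x : R) (m : int) :
  periodic f T -> f (x + T * m%:~R) = f x.
Proof.
move=> fT; case: m => k.
  by rewrite -pmulrn mulr_natr periodicn.
rewrite NegzE intrN mulrN -pmulrn mulr_natr.
by rewrite -[in RHS](subrK (T *+ k.+1) x) periodicn.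
Qed.

Lemma cos_turns x y :
  x - y \is a Num.int -> cos (2 * pi * x) = cos (2 * pi * y).
Proof.
move=> /intrP[m /eqP]; rewrite subr_eq addrC => /eqP ->.
by rewrite mulrDr periodic_intr// mulr_natl; exact: cosD2pi.
Qed.

Lemma sin_turns x y :
  x - y \is a Num.int -> sin (2 * pi * x) = sin (2 * pi * y).
Proof.
move=> /intrP[m /eqP]; rewrite subr_eq addrC => /eqP ->.
by rewrite mulrDr periodic_intr// mulr_natl; exact: sinD2pi.
Qed.

Lemma cos_turns_half x : cos (2 * pi * (1 / 2 - x)) = - cos (2 * pi * x).
Proof.
rewrite (_ : 2 * pi * _ = - (2 * pi * x) + pi); last by field.
by rewrite cosDpi cosN.
Qed.

Lemma sin_turns_half x : sin (2 * pi * (1 / 2 - x)) = sin (2 * pi * x).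
Proof.
rewrite (_ : 2 * pi * _ = - (2 * pi * x) + pi); last by field.
by rewrite sinDpi sinN opprK.
Qed.

Lemma cos_turns_gt0 x : - (1 / 4) < x < 1 / 4 -> 0 < cos (2 * pi * x).
Proof.
move=> /andP[lx xl]; apply: cos_gt0_pihalf.
by have := pi_gt0 R => ?; apply/andP; split; nra.
Qed.

(** Rounding brings [x] into [-1/2, 1/2), where the cosine is nonpositive outside (-1/4, 1/4). *)
Lemma cos_turns_gt0_near_int x :
  0 < cos (2 * pi * x) -> exists m : int, - (1 / 4) < x - m%:~R < 1 / 4.
Proof.
move=> cx; pose m := Num.floor (x + 1 / 2); exists m.
have := floor_itv (x + 1 / 2); rewrite -/m intrD => /andP[ml mr].
have cy : 0 < cos (2 * pi * (x - m%:~R)).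
  by rewrite -(cos_turns x)// subKr intr_int.
(* The reflection y -> 1/2 - y carries this range to [0, 1/4], where the cosine is nonnegative. *)
have far y : 1 / 4 <= y <= 1 / 2 -> cos (2 * pi * y) <= 0.
  move=> /andP[y1 y2]; rewrite -oppr_ge0 -cos_turns_half.
  by apply: cos_ge0_pihalf; have := pi_gt0 R => ?; apply/andP; split; nra.
apply: contraT; rewrite negb_and -!leNgt => /orP[] h.
  have /far : 1 / 4 <= - (x - m%:~R) <= 1 / 2 by apply/andP; split; lra.
  by rewrite mulrN cosN leNgt cy.
have /far : 1 / 4 <= x - m%:~R <= 1 / 2 by apply/andP; split; lra.
by rewrite leNgt cy.
Qed.

(** Congruences modulo 1 are added by [rpredD] and [rpredB]; this leaves a plain identity to [ring]
    or [field]. *)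
Lemma int_num_eq x y : x = y -> x \is a Num.int -> y \is a Num.int.
Proof. by move=> ->. Qed.

Lemma mod1_shift x y : x - y \is a Num.int -> mod1 x = mod1 y.
Proof.
move=> /intrP[m xy]; have -> : x = y + m%:~R by rewrite -xy; ring.
by rewrite /mod1 floorDrz ?intr_int// intrKfloor intrD; ring.
Qed.

Lemma mod1_int x : x - mod1 x \is a Num.int.
Proof. by rewrite /mod1 opprB addrCA subrr addr0 intr_int. Qed.

End Turns.

(** Only the restriction of [f] to a line matters, so the one-variable chain rule becomes
    available. *)
Lemma derive_line (R : realType) (V : normedModType R) (f : V -> R) (u v : V) :
  'D_v f u = 'D_1 (fun h : R => f (h *: v + u)) 0.
Proof.
rewrite /derive; apply: (congr1 (fun F => lim (fmap F (dnbhs (0 : R))))).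
apply/funext => h /=.
by rewrite scale0r add0r addr0 /GRing.scale /= mulr1.
Qed.

Lemma is_derive_affine (R : realType) (c k x : R) :
  is_derive x (1 : R) (fun h => c + h * k) k.
Proof.
rewrite (_ : (fun h => _) = cst c + k *: (@id R)); last first.
  by apply/funext => h; rewrite mulrC.
apply: is_derive_eq.
by rewrite add0r /GRing.scale /= mulr1.
Qed.

Lemma derive_kuramoto (R : realType) (n : nat) (K : R) (u v : 'rV[R]_n) :
  'D_v (kuramoto_potential K) u =
  K * \sum_(i < n)
    (v 0 (ordS i) - v 0 i) * sin (2 * pi * (u 0 (ordS i) - u 0 i)).
Proof.
rewrite derive_line.
pose d i := 2 * pi * (u 0 (ordS i) - u 0 i).
pose e i := 2 * pi * (v 0 (ordS i) - v 0 i).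
pose g i (h : R) := cos (d i + h * e i).
rewrite (_ : (fun h => _) = - (K / (2 * pi)) *: (\sum_(i < n) g i)); last first.
  apply/funext => h; rewrite /kuramoto_potential fctE fct_sumE.
  rewrite -[RHS]/(- (K / (2 * pi)) * _).
  congr (_ * _); apply: eq_bigr => i _.
  by rewrite /g /d /e !mxE; congr cos; ring.
have dg i : is_derive (0 : R) (1 : R) (g i) (- sin (d i) * e i).
  rewrite -[X in sin X]addr0 -[X in _ + X](mul0r (e i)).
  by apply: is_derive1_comp; exact: is_derive_affine.
have ds := is_derive_sum dg.
rewrite derive_val /GRing.scale /= mulNr -!mulrN -sumrN !mulr_sumr.
apply: eq_bigr => i _.
rewrite /d /e; have := lt0r_neq0 (pi_gt0 R); move: (@pi R) => p p0.
by field.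
Qed.

(** The common sine factors out of the derivative, leaving a sum of differences that telescopes to 0
    around the cycle. *)
Lemma equilibrium_sin (R : realType) (n : nat) (K s : R) (u : 'rV[R]_n) :
  (forall i, sin (2 * pi * (u 0 (ordS i) - u 0 i)) = s) -> equilibrium K u.
Proof.
move=> us; apply/rowP => i; rewrite !mxE derive_kuramoto.
under eq_bigr do rewrite us.
rewrite -mulr_suml sumrB.
rewrite [X in X - _](_ : _ = \sum_j (delta_mx 0 i : 'rV[R]_n) 0 j); last first.
  by rewrite [RHS](reindex_inj (@ordS_inj n)).
by rewrite subrr mul0r mulr0.
Qed.

Section Chain.
Variables (R : realType) (n : nat).
Implicit Type u : 'rV[R]_n.+1.

Lemma val_ordS (i : 'I_n.+1) : i != ord_max -> ordS i = i.+1 :> nat.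
Proof.
by move=> im; rewrite /= modn_small// ltnS ltn_neqAle im -ltnS ltn_ord.
Qed.

Lemma ordS_max : ordS (@ord_max n) = ord0.
Proof. by apply/val_inj; rewrite /= modnn. Qed.

(** Induction along the chain from [ord0]. The edge from [ord_max] back to [ord0] is left out, so
    [t] is not yet constrained. *)
Lemma linear_mod1P u (t : R) :
  (forall i, i != ord_max -> u 0 (ordS i) - u 0 i - t \is a Num.int) <->
  (forall i, u 0 i - u 0 ord0 - i%:R * t \is a Num.int).
Proof.
split=> [ut i|ut i im]; last first.
  have := rpredB (ut (ordS i)) (ut i); rewrite val_ordS// -natr1.
  by apply: int_num_eq; ring.
case: i => k; elim: k => [|k IHk] kn.
  by rewrite (_ : Ordinal kn = ord0) ?subrr ?mul0r ?subr0//; exact/val_inj.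
have kn' := ltnW kn.
have km : Ordinal kn' != ord_max by rewrite -val_eqE /= neq_ltn -ltnS kn.
have -> : Ordinal kn = ordS (Ordinal kn') by apply/ord_inj; rewrite val_ordS.
have := rpredD (ut _ km) (IHk kn'); rewrite val_ordS// -natr1.
by apply: int_num_eq; rewrite /=; ring.
Qed.

(** [u_r] is linear in the index with slope r / (n - 2), for n the number of oscillators, and starts
    at 0. Hence the phase can be taken to be [u 0 ord0], and the integer translation is what
    remains. *)
Lemma shift_equiv_u_rP u (r : R) :
  shift_equiv u (u_r n.+1 r) <->
  (forall i, u 0 i - u 0 ord0 - i%:R * (r / (n.+1%:R - 2)) \is a Num.int).
Proof.
have urE i : u_r n.+1 r 0 i = i%:R * (r / (n.+1%:R - 2)).
  have n0 : n.+1%:R != 0 :> R by rewrite pnatr_eq0.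
  (* The inverse is generalized because [n.+1%:R - 2] may vanish here. *)
  by rewrite mxE /qhat; move: (n.+1%:R) n0 (_ - 2)^-1 => N N0 w; field.
have vE phi k i : (u_r n.+1 r + const_mx phi + map_mx intr k) 0 i
    = i%:R * (r / (n.+1%:R - 2)) + phi + (k 0 i)%:~R by rewrite -urE !mxE.
split=> [[phi [k ->]] i|ui].
  rewrite !vE; apply: int_num_eq (intr_int R (k 0 i - k 0 ord0)).
  by rewrite intrB /=; ring.
exists (u 0 ord0).
exists (\row_i Num.floor (u 0 i - u 0 ord0 - i%:R * (r / (n.+1%:R - 2)))).
by apply/rowP => i; rewrite vE mxE floorK; [ring|exact: ui].
Qed.

End Chain.

Theorem lemma4p4 (R : realType) (n : nat) (K : R) (hn : (5 <= n)%N)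
    (hK : 0 < K) (u : 'rV[R]_n) :
  equilibrium K u /\ has_sigma u (last_minus n) <->
  exists r : R,
    [/\ half_integer r,
        - (n%:R / 4) + 1 / 2 < r < n%:R / 4 - 1 / 2 &
        shift_equiv u (u_r n r)].
Proof.
(* From here on there are [n.+1] oscillators, so n - 2 of the statement reads [n%:R - 1]. *)
case: n hn u => // n hn u.
have n3 : 3 <= n%:R :> R by rewrite ler_nat ltnW.
have n1 : n%:R - 1 != 0 :> R by apply: lt0r_neq0; lra.
have n2E : n.+1%:R - 2 = n%:R - 1 :> R by rewrite -natr1; ring.
split=> [[_ [a [b [ab bE /andP[_ ca] us]]]]|].
  have [m mt] := cos_turns_gt0_near_int _ _ ca; set t := a - m%:~R in mt.
  have ui i : i != ord_max -> phase_diff u i = a.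
    move=> im; have := us i; rewrite mxE.
    by rewrite [_ == n]negbTE//; case: eqP.
  have umax : phase_diff u ord_max = b.
    have : (range (phase_diff u)) (phase_diff u ord_max) by exists ord_max.
    rewrite ab => -[] // ua; have := us ord_max.
    by rewrite mxE /= eqxx ua eqxx.
  have /linear_mod1P ulin i :
      i != ord_max -> u 0 (ordS i) - u 0 i - t \is a Num.int.
    move=> /ui ia; rewrite /t -ia opprB addrCA.
    by rewrite rpredD ?intr_int ?mod1_int.
  (* The closing edge is congruent both to -n t, by linearity, and to 1/2 - t. In the sum below, [m]
     turns [a] into [t] and the -1 turns 1/2 into -1/2. *)
  have /intrP[k kE] : (n%:R - 1) * t - 1 / 2 \is a Num.int.
    have := mod1_int _ (1 / 2 - a); rewrite -bE => h1.
    have := mod1_int _ (u 0 (ordS ord_max) - u 0 ord_max).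
    rewrite -/(phase_diff u ord_max) umax ordS_max => h2.
    have := ulin ord_max => h3.
    have := rpredD (rpredB h1 h2) (rpredB (intr_int R (m - 1)) h3).
    by apply: int_num_eq; rewrite /t intrB /=; field.
  exists ((n%:R - 1) * t); split.
  - by exists k; rewrite -kE subrK.
  (* This is |t| < 1/4 scaled by n - 1, as (n - 1) / 4 = (n + 1) / 4 - 1/2. *)
  - by rewrite -natr1; case/andP: mt => ? ?; apply/andP; split; nra.
  - by apply/shift_equiv_u_rP; rewrite n2E mulrAC mulfV// mul1r.
move=> [r [[k rE] rn /shift_equiv_u_rP ulin]].
rewrite n2E in ulin; set t := r / _ in ulin.
have rt : r = (n%:R - 1) * t by rewrite /t mulrC divfK.
have tq : - (1 / 4) < t < 1 / 4.
  move: rn; rewrite rt -natr1 => /andP[r1 r2].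
  by apply/andP; split; nra.
have ui i : i != ord_max -> u 0 (ordS i) - u 0 i - t \is a Num.int.
  by move=> im; apply: (linear_mod1P _ _ u t).2.
(* The closing edge is congruent to -n t, and (n - 1) t = k + 1/2 since [r] is a half-integer. *)
have umax : u 0 (ordS ord_max) - u 0 ord_max - (1 / 2 - t) \is a Num.int.
  rewrite ordS_max -rpredN.
  have := rpredD (ulin ord_max) (intr_int R (k + 1)).
  apply: int_num_eq.
  have kE : k%:~R = (n%:R - 1) * t - 1 / 2 by rewrite -rt rE addrK.
  by rewrite intrD kE /=; field.
split.
  apply: (equilibrium_sin _ _ _ (sin (2 * pi * t))) => i.
  have [->|im] := eqVneq i ord_max.
    by rewrite -(sin_turns_half _ t); exact: sin_turns.
  exact/sin_turns/ui.
have uiE i : i != ord_max -> phase_diff u i = mod1 t by move=> /ui/mod1_shift.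
have umaxE : phase_diff u ord_max = mod1 (1 / 2 - t) by exact: mod1_shift.
have cos_mod1 x : cos (2 * pi * mod1 x) = cos (2 * pi * x).
  by apply/esym/cos_turns/mod1_int.
have ct : 0 < cos (2 * pi * t) by exact: cos_turns_gt0.
exists (mod1 t), (mod1 (1 / 2 - t)); split.
- apply/seteqP; split=> x.
    move=> [i _ <-]; have [->|/uiE ->] := eqVneq i ord_max; last by left.
    by right.
  move=> [->|->]; last by exists ord_max.
  (* The first value is attained at [ord0], which differs from [ord_max]. *)
  exists ord0 => //; rewrite uiE// -val_eqE /= eq_sym -lt0n -ltnS.
  exact: leq_trans hn.
- by apply: mod1_shift; rewrite -rpredN; apply: int_num_eq (mod1_int _ t); ring.
- by rewrite !cos_mod1 cos_turns_half oppr_lt0 ct.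
- move=> i; rewrite mxE /=; have [->|im] := eqVneq i ord_max.
    (* The two values cannot coincide, as their cosines have opposite signs. *)
    rewrite eqxx umaxE; case: eqP => // e; have := ct.
    by rewrite -cos_mod1 -e cos_mod1 cos_turns_half oppr_gt0 ltNge ltW.
  by rewrite uiE// eqxx ifN.
Qed.
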